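(* Let the directed hypergraph $\mathsf H$ be the union of a graph $\mathsf G$ with vertex set $\mathsf V$ and a hypergraph consisting of a unique hyperedge $e$ that contains all the vertices of $\mathsf G$ and such that any two vertices are co-oriented in $e$. Let $c$ denote the number of connected components of $\mathsf G$. Then (counting multiplicity) the spectrum of $\mathcal L_{\mathsf H}$ consists of $0$ (with multiplicity $c-1$), of $\#\mathsf V$, and of all non-zero eigenvalues of $\mathcal L_{\mathsf G}$. The lowest eigenvalue $\lambda_{\min}$ of $\mathcal L_{\mathsf H}$ is $\#\mathsf V$ if and only if $\mathsf G$ is the complete graph, and in this case the orthogonal projector onto the corresponding eigenspace is the identity. Otherwise, $\lambda_{\min}<\#\mathsf V$ and the orthogonal projector onto the eigenspace corresponding to $\lambda_{\min}$ is not a positive matrix.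
   Context: A directed hypergraph $\mathsf H=(\mathsf V,\mathsf E)$ consists of a finite set $\mathsf V$ (vertices) and a finite multiset $\mathsf E$ of hyperedges $e=(e_{\rm sour},e_{\rm targ})$, where $e_{\rm sour},e_{\rm targ}\subset\mathsf V$ are disjoint (possibly empty) sets. The incidence matrix is the $\mathsf V\times\mathsf E$-matrix $\mathcal I=(\iota_{ve})$ with $\iota_{ve}=+1$ if $v\in e_{\rm targ}$, $-1$ if $v\in e_{\rm sour}$, $0$ otherwise; the Laplacian is $\mathcal L:=\mathcal I\mathcal I^\top$, written $\mathcal L_{\mathsf H}$ or $\mathcal L_{\mathsf G}$ to indicate the hypergraph or graph. Two vertices are co-oriented in $e$ if both belong to $e_{\rm sour}$ or both belong to $e_{\rm targ}$. A graph is regarded (with an arbitrary orientation of its edges) as a directed hypergraph all of whose hyperedges have singleton source and target sets, so that $\mathcal L_{\mathsf G}$ is the usual graph Laplacian. The union of two directed hypergraphs on the same vertex set is the directed hypergraph on that vertex set whose hyperedge multiset is the union of the two hyperedge multisets; its incidence matrix is obtained by juxtaposing the columns of the two incidence matrices. $\#\mathsf V$ is the number of vertices. A matrix is called positive if all its entries are real and $\ge 0$. *)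

(* Defs.v *)
From HB Require Import structures.
From mathcomp Require Import all_boot all_order all_algebra.

Set Implicit Arguments.
Unset Strict Implicit.
Unset Printing Implicit Defensive.

Import Order.TTheory GRing.Theory Num.Theory.
Local Open Scope ring_scope.

Record hyperedge (V : finType) := Hyperedge {
  sour : {set V};
  targ : {set V};
  sour_targ_disjoint : [disjoint sour & targ]
}.

(* The multiset of hyperedges is a family over a finite index type, so that
   repeated hyperedges are allowed. *)
Record dhypergraph (V : finType) := DHypergraph {
  hedges : finType;
  hedge : hedges -> hyperedge V
}.

Definition cooriented (V : finType) (e : hyperedge V) (u v : V) : bool :=
  (u \in sour e) && (v \in sour e) || (u \in targ e) && (v \in targ e).

Definition hunion (V : finType) (H1 H2 : dhypergraph V) : dhypergraph V :=
  DHypergraph (fun i : hedges H1 + hedges H2 =>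
    match i with inl i1 => hedge i1 | inr i2 => hedge i2 end).

Definition hsingle (V : finType) (e : hyperedge V) : dhypergraph V :=
  DHypergraph (fun _ : unit => e).

(* G is the simple graph with adjacency relation adj, each of its edges being
   counted once and given an arbitrary orientation. *)
Definition is_orientation (V : finType) (adj : rel V) (G : dhypergraph V) : Prop :=
  (forall i : hedges G, exists x y : V,
     [/\ adj x y, sour (hedge i) = [set x] & targ (hedge i) = [set y]]) /\
  (forall x y : V, adj x y -> exists! i : hedges G,
     (sour (hedge i) = [set x] /\ targ (hedge i) = [set y]) \/
     (sour (hedge i) = [set y] /\ targ (hedge i) = [set x])).

Definition complete_graph (V : finType) (adj : rel V) : Prop :=
  forall x y : V, x != y -> adj x y.

Definition iota_ve (C : pzRingType) (V : finType) (v : V) (e : hyperedge V) : C :=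
  if v \in targ e then 1 else if v \in sour e then -1 else 0.

Definition incidence (C : pzRingType) (V : finType) (H : dhypergraph V) :
    'M[C]_(#|V|, #|hedges H|) :=
  \matrix_(v, i) iota_ve C (enum_val v) (hedge (enum_val i)).

Definition laplacian (C : pzRingType) (V : finType) (H : dhypergraph V) :
    'M[C]_#|V| :=
  incidence C H *m (incidence C H)^T.

(* The roots of the characteristic polynomial, each repeated according to its
   multiplicity, in an unspecified order. *)
Definition spectrum (C : numClosedFieldType) (n : nat) (A : 'M[C]_n) : seq C :=
  sval (closed_field_poly_normal (char_poly A)).

(* In a numClosedFieldType, a <= b means that b - a is real and nonnegative. *)
Definition lowest_eigenvalue (C : numClosedFieldType) (n : nat) (A : 'M[C]_n)
    (a : C) : Prop :=
  eigenvalue A a /\ forall b : C, eigenvalue A b -> a <= b.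

Definition positive_mx (C : numClosedFieldType) (n : nat) (A : 'M[C]_n) : Prop :=
  forall i j, 0 <= A i j.

(* Main.v *)
Require Import Defs.
From HB Require Import structures.
From mathcomp Require Import all_boot all_order all_algebra ring.

Set Implicit Arguments.
Unset Strict Implicit.
Unset Printing Implicit Defensive.

Import Order.TTheory GRing.Theory Num.Theory.
Local Open Scope ring_scope.
Local Open Scope sesquilinear_scope.

(** Write L for the Laplacian of G, J for the all-ones matrix and n for the
    number of vertices.  The big hyperedge contributes J to the Laplacian of H,
    so the theorem is about L + J, and two identities settle it.

    Spectrum.  The rows of L sum to zero, so L J = 0 and
    X (X - L - J) = (X - L) (X - J).  Taking determinants, with J having
    eigenvalues n and 0 (n - 1 times), gives
    X * char(L + J) = (X - n) * char(L): one zero of the spectrum of L is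
    traded for n ([perm_spectrum_add_ones]).  Since L is symmetric, 0 occurs in
    its spectrum dim ker L times ([count_zero_spectrum]), and ker L consists of
    the vectors that are constant on the connected components, because the
    quadratic form of L is the sum of |x_i - x_j|^2 over the edges
    ([rank_ker_rel_laplacian]).

    Lowest eigenvalue.  L + J = n - K, where K is the Laplacian of the
    complementary graph ([rel_laplacian_compl]).  K is positive semidefinite, so
    all eigenvalues of L + J are at most n, and they are all equal to n exactly
    when K = 0, that is, when G is complete.  If the lowest eigenvalue is below
    n, its eigenspace is orthogonal to the all-ones vector, which is an
    eigenvector for n.  The orthogonal projector onto it therefore has columns
    of zero sum, and having only nonnegative entries would force it to vanish
    ([proj_ortho_not_positive]). *)

(** * Spectra of matrices *)

Lemma char_poly_spectrum (C : numClosedFieldType) n (A : 'M[C]_n) :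
  char_poly A = \prod_(a <- spectrum A) ('X - a%:P).
Proof.
rewrite /spectrum; case: closed_field_poly_normal => s /= {1}->.
by rewrite (monicP (char_poly_monic A)) scale1r.
Qed.

Lemma perm_spectrum (C : numClosedFieldType) n (A : 'M[C]_n) (s : seq C) :
  char_poly A = \prod_(a <- s) ('X - a%:P) -> perm_eq (spectrum A) s.
Proof. by rewrite char_poly_spectrum => /prod_XsubC_eq. Qed.

Lemma size_spectrum (C : numClosedFieldType) n (A : 'M[C]_n) :
  size (spectrum A) = n.
Proof.
by apply/succn_inj; rewrite -(size_char_poly A) char_poly_spectrum size_prod_XsubC.
Qed.

Lemma mem_spectrum (C : numClosedFieldType) n (A : 'M[C]_n) a :
  (a \in spectrum A) = eigenvalue A a.
Proof. by rewrite eigenvalue_root_char char_poly_spectrum root_prod_XsubC. Qed.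

Lemma char_poly_conj (R : comUnitRingType) n (P A : 'M[R]_n) :
  P \in unitmx -> char_poly (invmx P *m A *m P) = char_poly A.
Proof.
move=> uP; pose Q := map_mx (@polyC R) P; pose Q' := map_mx (@polyC R) (invmx P).
have Q'Q : Q' *m Q = 1%:M by rewrite -map_mxM mulVmx // map_mx1.
rewrite /char_poly.
have -> : char_poly_mx (invmx P *m A *m P) = Q' *m char_poly_mx A *m Q.
  rewrite /char_poly_mx !map_mxM /= mulmxBr mulmxBl; congr (_ - _).
  by rewrite scalar_mxC -mulmxA Q'Q mulmx1.
by rewrite !det_mulmx mulrAC -det_mulmx Q'Q det1 mul1r.
Qed.

Lemma perm_nseq_filter (T : eqType) (x : T) (s : seq T) :
  perm_eq s (nseq (count_mem x s) x ++ [seq a <- s | a != x]).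
Proof.
rewrite -(perm_filterC (pred1 x) s) -size_filter.
by rewrite -(all_pred1P x _ (filter_all (pred1 x) s)).
Qed.

Lemma spectrum_normal (C : numClosedFieldType) n (A : 'M[C]_n) :
  A \is normalmx ->
  perm_eq (spectrum A) [seq spectral_diag A 0 i | i <- enum 'I_n].
Proof.
move=> /orthomx_spectralP AE; apply: perm_spectrum.
rewrite {1}AE char_poly_conj ?spectral_unit //.
rewrite char_poly_trig ?diag_mx_is_trig // big_map big_enum /=.
by apply: eq_bigr => i _; rewrite mxE eqxx.
Qed.

(** The row space of a diagonal matrix is the direct sum of the coordinate lines
    on which the diagonal is nonzero. *)
Lemma rank_diag_mx (F : fieldType) n (d : 'rV[F]_n) :
  \rank (diag_mx d) = #|[pred i | d 0 i != 0]|.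
Proof.
have rowd i : row i (diag_mx d) = d 0 i *: delta_mx 0 i.
  by apply/rowP => j; rewrite !mxE eqxx /= eq_sym mulr_natr.
have eqd : (diag_mx d :=: \sum_(i | d 0 i != 0) <<delta_mx 0 i : 'rV_n>>)%MS.
  apply/eqmxP/andP; split.
    apply/row_subP => i; rewrite rowd; have [->|di0] := eqVneq (d 0 i) 0.
      by rewrite scale0r sub0mx.
    by rewrite scalemx_sub // (sumsmx_sup i) // genmxE.
  apply/sumsmx_subP => i di0; rewrite genmxE -[delta_mx 0 i]scale1r -(mulVf di0).
  by rewrite -scalerA -rowd scalemx_sub // row_sub.
rewrite eqd (mxdirectP (mxdirect_delta _ (in2W (@inj_id _)))) /= -sum1_card.
by apply: eq_bigr => i _; rewrite mxrank_gen mxrank_delta.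
Qed.

(** Algebraic and geometric multiplicities of 0 agree because a normal matrix is
    diagonalizable. *)
Lemma count_zero_spectrum (C : numClosedFieldType) n (A : 'M[C]_n) :
  A \is normalmx -> count_mem 0 (spectrum A) = (n - \rank A)%N.
Proof.
move=> nA; rewrite (permP (spectrum_normal nA)) count_map.
move/orthomx_spectralP: nA => {2}->.
rewrite mxrankMfree ?row_free_unit ?spectral_unit //.
rewrite eqmxMfull ?row_full_unit ?unitmx_inv ?spectral_unit //.
rewrite rank_diag_mx; set d := spectral_diag A.
apply: (canRL (addKn _)); rewrite -[RHS]card_ord -(cardC [pred i | d 0 i != 0]).
congr (_ + _)%N.
rewrite -size_filter cardE /enum_mem filter_predT; congr size.
by apply: eq_filter => i; rewrite !inE negbK.
Qed.

(** From (X - A) (X - B) = X (X - (A + B)), which is where A B = 0 enters. *)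
Lemma char_poly_add (R : comNzRingType) n (A B : 'M[R]_n) :
  A *m B = 0 -> 'X ^+ n * char_poly (A + B) = char_poly A * char_poly B.
Proof.
move=> AB0; rewrite /char_poly -det_mulmx -det_scalar -det_mulmx; congr (\det _).
rewrite /char_poly_mx map_mxD mulmxBr mulmxDr.
rewrite mulmxBl !mulmxBr -map_mxM AB0 map_mx0 subr0 (scalar_mxC 'X (map_mx _ A)).
by rewrite opprD [in RHS]addrAC addrA.
Qed.

(** * Adding the all-ones matrix *)

Lemma ones_factor (R : pzRingType) n :
  const_mx 1 = (const_mx 1 : 'cV_n) *m (const_mx 1 : 'rV_n) :> 'M[R]_n.
Proof. by apply/matrixP => i j; rewrite !mxE big_ord1 !mxE mulr1. Qed.

Lemma ones_mul (R : pzRingType) n :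
  (const_mx 1 : 'rV[R]_n) *m (const_mx 1 : 'cV_n) = n%:R%:M.
Proof.
apply/matrixP => i j; rewrite !ord1 !mxE -[RHS]/(n%:R).
under eq_bigr do rewrite !mxE mulr1.
by rewrite sumr_const card_ord.
Qed.

Lemma ones_normal (C : numClosedFieldType) n : (const_mx 1 : 'M[C]_n) \is normalmx.
Proof. by apply/normalmxP; rewrite trmx_const map_const_mx rmorph1. Qed.

(** J has rank one and is symmetric, so 0 occurs n - 1 times; the one remaining
    eigenvalue is n, whose eigenvector is the all-ones vector. *)
Lemma spectrum_ones (C : numClosedFieldType) n : (0 < n)%N ->
  perm_eq (spectrum (const_mx 1 : 'M[C]_n)) (n%:R :: nseq n.-1 0).
Proof.
move=> n_gt0; set J := const_mx 1; set s := spectrum J.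
have nn0 : n%:R != 0 :> C by rewrite pnatr_eq0 -lt0n.
have ones0 : (const_mx 1 : 'rV[C]_n) != 0.
  by apply/negP => /eqP/rowP/(_ (Ordinal n_gt0))/eqP; rewrite !mxE oner_eq0.
have rkJ : \rank J = 1%N.
  rewrite /J ones_factor mxrankMfree; last by rewrite /row_free rank_rV ones0.
  by rewrite -mxrank_tr trmx_const rank_rV ones0.
have c0 : count_mem 0 s = n.-1 by rewrite count_zero_spectrum ?ones_normal // rkJ subn1.
have ns : n%:R \in [seq a <- s | a != 0].
  rewrite mem_filter nn0 mem_spectrum; apply/eigenvalueP; exists (const_mx 1) => //.
  by rewrite /J ones_factor mulmxA ones_mul mul_scalar_mx.
have sz : size [seq a <- s | a != 0] = 1%N.
  have := perm_size (perm_nseq_filter 0 s).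
  rewrite size_spectrum size_cat size_nseq c0 -[LHS](prednK n_gt0) -addn1.
  by move/addnI.
move: (perm_nseq_filter 0 s) ns; case: (filter _ _) sz => [|a [|? ?]] // _.
by rewrite c0 inE => + /eqP->; rewrite -cat1s perm_sym perm_catC perm_sym.
Qed.

(** The product formula applied to A and J reads
    X^n char(A + J) = char(A) X^(n-1) (X - n), and X^(n-1) cancels.  The factor X
    that is left over is the extra 0 on the left: it stands for the zero of the
    spectrum of A that n replaces. *)
Lemma perm_spectrum_add_ones (C : numClosedFieldType) n (A : 'M[C]_n) :
  (0 < n)%N -> A *m const_mx 1 = 0 :> 'cV_n ->
  perm_eq (0 :: spectrum (A + const_mx 1)) (n%:R :: spectrum A).
Proof.
move=> n_gt0 A1; apply/prod_XsubC_eq; rewrite !big_cons -!char_poly_spectrum subr0.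
have AJ : A *m (const_mx 1 : 'M_n) = 0 by rewrite ones_factor mulmxA A1 mul0mx.
have cJ : char_poly (const_mx 1 : 'M[C]_n) = ('X - n%:R%:P) * 'X ^+ n.-1.
  rewrite char_poly_spectrum (perm_big _ (spectrum_ones C n_gt0)) big_cons.
  by congr (_ * _); rewrite big_nseq iter_mulr_1 subr0.
have X0 : 'X ^+ n.-1 != 0 :> {poly C} by rewrite expf_neq0 ?polyX_eq0.
apply: (mulfI X0); rewrite mulrA -exprSr prednK // char_poly_add // cJ.
by rewrite mulrA mulrC [char_poly A * _]mulrC.
Qed.

(** * Laplacians of relations *)

(** The diagonal also counts the loops of r, which the second term then
    subtracts again: loops do not affect the Laplacian.  This is what lets the
    complementary graph below be given by the plain negation of r. *)
Definition rel_laplacian (R : pzRingType) n (r : rel 'I_n) : 'M[R]_n :=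
  diag_mx (\row_i \sum_j (r i j)%:R) - \matrix_(i, j) (r i j)%:R.

Lemma rel_laplacianE (R : pzRingType) n (r : rel 'I_n) i j :
  rel_laplacian R r i j = (\sum_k (r i k)%:R) *+ (i == j) - (r i j)%:R.
Proof. by rewrite !mxE. Qed.

Lemma rel_laplacian_ones (R : pzRingType) n (r : rel 'I_n) :
  rel_laplacian R r *m const_mx 1 = 0 :> 'cV_n.
Proof.
apply/colP => i; rewrite mulmxBl mul_diag_mx !mxE mulr1.
by under [X in _ - X]eq_bigr do rewrite !mxE mulr1; rewrite subrr.
Qed.

(** Negating r replaces its degrees d by n - d and its adjacency matrix M by
    J - M. *)
Lemma rel_laplacian_compl (R : pzRingType) n (r : rel 'I_n) :
  rel_laplacian R (fun i j => ~~ r i j) =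
  n%:R%:M - (rel_laplacian R r + const_mx 1).
Proof.
have neg (b : bool) : (~~ b)%:R = 1 - b%:R :> R by case: b; rewrite ?subrr ?subr0.
apply/matrixP => i j; rewrite !mxE neg; under eq_bigr do rewrite neg.
rewrite sumrB sumr_const card_ord mulrnBl; set d := (\sum__ _) *+ _; set b := _%:R.
by rewrite !opprD !opprK -!addrA; congr (_ + _); congr (_ + _); rewrite addrC.
Qed.

Lemma rel_laplacian_symmetric (R : pzRingType) n (r : rel 'I_n) :
  symmetric r -> (rel_laplacian R r)^T = rel_laplacian R r.
Proof.
move=> sr; rewrite /rel_laplacian linearB /= tr_diag_mx; congr (_ - _).
by apply/matrixP => i j; rewrite !mxE sr.
Qed.

Lemma rel_laplacian_real (C : numClosedFieldType) n (r : rel 'I_n) :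
  rel_laplacian C r \is a realmx.
Proof.
apply/mxOverP => i j; rewrite !mxE realB ?realn //.
by apply: rpredMn; apply: rpred_sum => k _; apply: realn.
Qed.

Lemma rel_laplacian_hermitian (C : numClosedFieldType) n (r : rel 'I_n) :
  symmetric r -> rel_laplacian C r \is hermsymmx.
Proof.
move=> sr; apply: realsym_hermsym (rel_laplacian_real _ _).
by apply/is_hermitianmxP; rewrite expr0 scale1r map_mx_id // rel_laplacian_symmetric.
Qed.

(** The Dirichlet form of r.  The factor 2 is there because each edge is counted
    in both directions. *)
Lemma rel_laplacian_form (C : numClosedFieldType) n (r : rel 'I_n) (x : 'rV[C]_n) :
  symmetric r ->
  (x *m rel_laplacian C r *m x^t*) 0 0 *+ 2 =
  \sum_i \sum_j (r i j)%:R * `|x 0 i - x 0 j| ^+ 2.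
Proof.
move=> sr.
have E : (x *m rel_laplacian C r *m x^t*) 0 0 =
   \sum_i \sum_j (r i j)%:R * (x 0 i * (x 0 i)^* - x 0 i * (x 0 j)^*).
  rewrite mulmxBr mulmxBl mxE [X in _ + X]mxE mul_mx_diag !mxE.
  have -> : \sum_j (x *m \matrix_(i, j0) (r i j0)%:R) 0 j * x^t* j 0 =
      \sum_i \sum_j (r i j)%:R * (x 0 i * (x 0 j)^*).
    rewrite exchange_big /=; apply: eq_bigr => j _; rewrite !mxE mulr_suml.
    by apply: eq_bigr => i _; rewrite !mxE; ring.
  rewrite -sumrB; apply: eq_bigr => i _; rewrite !mxE mulr_sumr mulr_suml -sumrB.
  by apply: eq_bigr => j _; ring.
rewrite mulr2n {1}E E [X in _ + X]exchange_big -big_split /=.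
apply: eq_bigr => i _; rewrite -big_split; apply: eq_bigr => j _ /=.
rewrite (sr j i) -mulrDr normCK rmorphB /=; ring.
Qed.

(** If x is in the kernel, the Dirichlet form vanishes at x, hence so does each of
    its nonnegative terms. *)
Lemma rel_laplacian_ker (C : numClosedFieldType) n (r : rel 'I_n) (x : 'rV[C]_n) :
  symmetric r ->
  x *m rel_laplacian C r = 0 <-> forall i j, r i j -> x 0 i = x 0 j.
Proof.
move=> sr; split=> [x0 i j rij | xr].
  have := rel_laplacian_form x sr; rewrite x0 mul0mx mxE mul0rn => /esym F0.
  have ge0 k l : 0 <= (r k l)%:R * `|x 0 k - x 0 l| ^+ 2.
    by rewrite mulr_ge0 ?ler0n ?exprn_ge0.
  have Fi := psumr_eq0P (fun k _ => sumr_ge0 _ (fun l _ => ge0 k l)) F0 (i := i) isT.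
  have /eqP := psumr_eq0P (fun l _ => ge0 i l) Fi (i := j) isT.
  by rewrite rij mul1r sqrf_eq0 normr_eq0 subr_eq0 => /eqP.
apply/rowP => j; rewrite mulmxBr mul_mx_diag !mxE mulr_sumr -sumrB big1 // => i _.
rewrite !mxE sr; case: (boolP (r i j)) => [/xr->|_]; first by rewrite subrr.
by rewrite !mulr0 subr0.
Qed.

Lemma rel_laplacian_eigenvalue_ge0 (C : numClosedFieldType) n (r : rel 'I_n) a :
  symmetric r -> eigenvalue (rel_laplacian C r) a -> 0 <= a.
Proof.
move=> sr /eigenvalueP[x xL x0].
have := rel_laplacian_form x sr; rewrite xL -scalemxAl mxE -dotmxE => F.
have x_gt0 := dotmx_is_dotmx x0.
rewrite -(pmulr_lge0 _ x_gt0) -(pmulrn_lge0 _ (ltn0Sn 1)) F.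
by apply: sumr_ge0 => i _; apply: sumr_ge0 => j _; rewrite mulr_ge0 ?ler0n ?exprn_ge0.
Qed.

(** The indicator vectors of the components form a basis of the kernel.  A
    component is represented by its root; restricting an indicator vector to the
    roots gives a coordinate vector, so the indicators are free. *)
Lemma rank_ker_rel_laplacian (C : numClosedFieldType) (V : finType) (adj : rel V) :
  symmetric adj ->
  \rank (kermx (rel_laplacian C (relpre (@enum_val V predT) adj))) = n_comp adj predT.
Proof.
move=> sadj; set r := relpre _ _; have sr : symmetric r by move=> i j; apply: sadj.
have sc : connect_sym adj by apply: sym_connect_sym.
pose root_of v := fingraph.root adj v; pose A := predI (roots adj) (mem predT).
have rootA v : root_of v \in A by rewrite !inE roots_root.
rewrite -[RHS]/#|A|.
pose B : 'M[C]_(#|A|, #|V|) :=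
  \matrix_(k, j) (root_of (enum_val j) == enum_val k)%:R.
pose S : 'M[C]_(#|V|, #|A|) := \matrix_(j, k) (enum_val j == enum_val k)%:R.
have BS : B *m S = 1%:M.
  apply/matrixP => k l; rewrite !mxE (bigD1 (enum_rank (enum_val l))) //= big1.
    rewrite !mxE enum_rankK eqxx mulr1 addr0.
    have /andP[/eqP rl _] : enum_val l \in A := enum_valP l.
    by rewrite /root_of rl (inj_eq enum_val_inj) eq_sym.
  move=> j jl; rewrite !mxE; case: (enum_val j =P enum_val l) => [jE|_]; last by rewrite mulr0.
  by case/eqP: jl; rewrite -jE enum_valK.
have rkB : \rank B = #|A|.
  by apply/eqP/row_freeP; exists S.
rewrite -rkB; apply/eqmx_rank/andP; split.
  apply/rV_subP => u /sub_kermxP /(rel_laplacian_ker _ sr) ur.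
  (* The coordinates of u in the indicator basis are its values at the roots. *)
  pose f v := u 0 (enum_rank v).
  have fr v w : connect adj v w -> f v = f w.
    move=> /connectP[p + ->]; elim: p v => //= v' p IH v /andP[vv' /IH <-].
    by apply: ur; rewrite /r /= !enum_rankK.
  apply/submxP; exists (\row_k f (enum_val k)); apply/rowP => j; rewrite !mxE.
  have rj := rootA (enum_val j).
  rewrite (bigD1 (enum_rank_in rj (root_of (enum_val j)))) //= big1 => [|k kj].
    rewrite !mxE enum_rankK_in // eqxx mulr1 addr0.
    by rewrite -(fr (enum_val j)) ?connect_root // /f enum_valK.
  rewrite !mxE; case: (_ =P enum_val k) => [jE|_]; last by rewrite mulr0.
  by case/eqP: kj; apply: enum_val_inj; rewrite enum_rankK_in.
apply/row_subP => k; apply/sub_kermxP/(rel_laplacian_ker _ sr) => i j rij.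
rewrite !mxE; congr (_ == _)%:R; apply/(fingraph.rootP sc).
exact: connect1.
Qed.

Lemma n_comp_gt0 (V : finType) (adj : rel V) :
  (0 < #|V|)%N -> symmetric adj -> (0 < n_comp adj predT)%N.
Proof.
move=> /card_gt0P[v _] sadj; apply/card_gt0P; exists (fingraph.root adj v).
by rewrite !inE roots_root //; apply: sym_connect_sym.
Qed.

(** * Laplacians of hypergraphs *)

Lemma laplacianE (R : pzRingType) (V : finType) (H : dhypergraph V) i j :
  laplacian R H i j =
  \sum_(k : hedges H) iota_ve R (enum_val i) (hedge k) * iota_ve R (enum_val j) (hedge k).
Proof.
by rewrite !mxE [RHS]big_enum_val; apply: eq_bigr => k _; rewrite !mxE.
Qed.

Lemma laplacian_hunion (R : pzRingType) (V : finType) (H1 H2 : dhypergraph V) :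
  laplacian R (hunion H1 H2) = laplacian R H1 + laplacian R H2.
Proof. by apply/matrixP => i j; rewrite [RHS]mxE !laplacianE big_sumType. Qed.

Lemma laplacian_hsingle (R : pzRingType) (V : finType) (e : hyperedge V) :
  (forall u v, cooriented e u v) -> laplacian R (hsingle e) = const_mx 1.
Proof.
move=> co; apply/matrixP => i j; rewrite laplacianE mxE (big_pred1 tt); last by case.
rewrite /iota_ve /=; have /setDidPl := sour_targ_disjoint e.
move=> dis; have := co (enum_val i) (enum_val j).
have nt v : v \in sour e -> (v \in targ e) = false.
  by rewrite -dis inE => /andP[/negbTE].
case/orP=> /andP[ei ej]; last by rewrite ei ej mulr1.
by rewrite !nt // ei ej mulrNN mulr1.
Qed.

Lemma iota_edge (R : pzRingType) (V : finType) (e : hyperedge V) x y v :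
  sour e = [set x] -> targ e = [set y] ->
  iota_ve R v e = (v == y)%:R - (v == x)%:R.
Proof.
move=> sx ty; have := sour_targ_disjoint e; rewrite sx ty disjoints1 inE => xy.
rewrite /iota_ve sx ty !inE; case: (eqVneq v y) => [->|_].
  by rewrite eq_sym (negbTE xy) subr0.
by rewrite sub0r; case: (v == x); rewrite ?oppr0.
Qed.

(** Only the off-diagonal entries need the edges between two given vertices; the
    diagonal follows, since both matrices have zero row sums: each column of the
    incidence matrix has one entry 1 and one entry -1. *)
Lemma laplacian_graph (R : pzRingType) (V : finType) (adj : rel V) (G : dhypergraph V) :
  symmetric adj -> irreflexive adj -> is_orientation adj G ->
  laplacian R G = rel_laplacian R (relpre (@enum_val V predT) adj).
Proof.
move=> sadj iadj [Gadj adjG].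
have ends u v (k : hedges G) : u != v -> iota_ve R u (hedge k) * iota_ve R v (hedge k) != 0 ->
    sour (hedge k) = [set u] /\ targ (hedge k) = [set v] \/
    sour (hedge k) = [set v] /\ targ (hedge k) = [set u].
  have [x [y [_ s t]]] := Gadj k; rewrite !(iota_edge _ _ s t) s t => uv.
  have [uy|uy] := eqVneq u y; have [ux|ux] := eqVneq u x;
    have [vy|vy] := eqVneq v y; have [vx|vx] := eqVneq v x;
    rewrite ?subrr ?mul0r ?mulr0 ?eqxx //; subst; rewrite ?eqxx // in uv *; by [left|right].
have off i j : i != j -> laplacian R G i j = - (adj (enum_val i) (enum_val j))%:R.
  move=> ij; rewrite laplacianE; set u := enum_val i; set v := enum_val j.
  have uv : u != v by rewrite (inj_eq enum_val_inj).
  have [auv|nauv] := boolP (adj u v); last first.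
    rewrite oppr0 big1 // => k _; apply/eqP; apply: contraNT nauv => /(ends _ _ _ uv).
    have [x [y [axy -> ->]]] := Gadj k.
    by case=> -[/set1_inj <- /set1_inj <-] //; rewrite sadj.
  have [k [kuv kuniq]] := adjG _ _ auv; rewrite (bigD1 k) //= big1 => [|k' k'k].
    rewrite addr0; case: kuv => -[s t]; rewrite !(iota_edge _ _ s t) !eqxx;
      by rewrite [v == u]eq_sym (negbTE uv) subr0 sub0r ?mulN1r ?mul1r.
  by apply/eqP; apply: contraNT k'k => /(ends _ _ _ uv)/kuniq->.
have zero i : \sum_j laplacian R G i j = 0.
  under eq_bigr do rewrite laplacianE.
  rewrite exchange_big big1 // => k _ /=; rewrite -mulr_sumr.
  have [x [y [axy s t]]] := Gadj k.
  under eq_bigr do rewrite (iota_edge _ _ s t).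
  have sum0 : \sum_(v : V) ((v == y)%:R - (v == x)%:R) = 0 :> R.
    by rewrite sumrB -!natr_sum -!big_mkcond /= !big_pred1_eq subrr.
  by rewrite big_enum_val in sum0; rewrite sum0 mulr0.
apply/matrixP => i j; rewrite rel_laplacianE /=.
have [<-|ij] := eqVneq i j; last by rewrite off // mulr0n sub0r.
rewrite iadj subr0 mulr1n; rewrite [RHS](bigD1 i) //= iadj add0r.
move/eqP: (zero i); rewrite (bigD1 i) //= addr_eq0 => /eqP->; rewrite -sumrN.
by apply: eq_bigr => k ki; rewrite off ?opprK // eq_sym.
Qed.

(** * The lowest eigenvalue *)

Lemma real_seq_min (C : numDomainType) (s : seq C) :
  s != [::] -> {subset s <= Num.real} -> exists2 m, m \in s & {in s, forall a, m <= a}.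
Proof.
elim: s => // a [|b s] IH _ sR.
  by exists a; rewrite ?mem_head // => ? /[1!inE] /eqP->.
have sR' : {subset b :: s <= Num.real}.
  by move=> c cs; apply: sR; rewrite in_cons cs orbT.
have [m ms mle] := IH isT sR'.
have [am|ma] := real_leP (sR a (mem_head _ _)) (sR' _ ms).
  exists a; rewrite ?mem_head // => c; rewrite inE => /predU1P[->//|/mle].
  exact: le_trans.
exists m; first by rewrite in_cons ms orbT.
by move=> c; rewrite inE => /predU1P[->|/mle//]; apply: ltW.
Qed.

Lemma eigenvalue_scalar_sub (F : fieldType) n (A : 'M[F]_n) (c a : F) :
  eigenvalue A a -> eigenvalue (c%:M - A) (c - a).
Proof.
move=> /eigenvalueP[v vA v0]; apply/eigenvalueP; exists v => //.
by rewrite mulmxBr mul_mx_scalar vA scalerBl.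
Qed.

(** A diagonalizable matrix is zero as soon as all its eigenvalues are. *)
Lemma rel_laplacian_spectrum0 (C : numClosedFieldType) n (r : rel 'I_n) :
  symmetric r -> (forall a, eigenvalue (rel_laplacian C r) a -> a = 0) ->
  rel_laplacian C r = 0.
Proof.
move=> sr e0; have nL := hermitian_normalmx (rel_laplacian_hermitian C sr).
move/orthomx_spectralP: (nL) => ->.
suff -> : spectral_diag (rel_laplacian C r) = 0.
  by rewrite linear0 mulmx0 mul0mx.
apply/rowP => i; rewrite [RHS]mxE; apply: e0.
by rewrite -mem_spectrum (perm_mem (spectrum_normal nL)) map_f ?mem_enum.
Qed.

Lemma rel_laplacian_eq0P (C : numClosedFieldType) n (r : rel 'I_n) :
  rel_laplacian C r = 0 <-> forall i j, i != j -> ~~ r i j.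
Proof.
split=> [L0 i j ij | r0].
  move/matrixP/(_ i j): L0; rewrite rel_laplacianE (negbTE ij) mulr0n sub0r mxE.
  by move/eqP; rewrite oppr_eq0 pnatr_eq0 eqb0.
apply/matrixP => i j; rewrite rel_laplacianE mxE.
have [<-|ij] := eqVneq i j; last by rewrite (negbTE (r0 i j ij)) mulr0n subrr.
rewrite mulr1n (bigD1 i) //= big1 ?addr0 ?subrr // => k ki.
by rewrite (negbTE (r0 i k _)) // eq_sym.
Qed.

(** When the row space of E is orthogonal to the all-ones vector, that vector is
    killed by the projector P, so that each column of P sums to zero; nonnegative
    entries would then all vanish. *)
Lemma proj_ortho_not_positive (C : numClosedFieldType) n (E : 'M[C]_n) :
  E != 0 -> E *m const_mx 1 = 0 :> 'cV_n -> ~ positive_mx (proj_ortho E).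
Proof.
move=> E0 E1 P_ge0; set P := proj_ortho E in P_ge0.
have P1 : (const_mx 1 : 'rV_n) *m P = 0.
  apply: proj_ortho_0; apply/orthomx1P.
  by rewrite -[const_mx 1]trmxCK trmx_const map_const_mx rmorph1 -map_mxM -trmx_mul E1 trmx0 map_mx0.
case/eqP: E0; apply/eqP; rewrite -mxrank_eq0 -(proj_orthoE E) mxrank_eq0 -/P.
apply/eqP/matrixP => i j; rewrite [RHS]mxE.
move/rowP/(_ j): P1; rewrite [LHS]mxE [RHS]mxE.
under eq_bigr do rewrite [const_mx 1 _ _]mxE mul1r.
by move=> sum0; apply: psumr_eq0P sum0 i isT => k _; apply: P_ge0.
Qed.

Theorem lemma3p8 (C : numClosedFieldType) (V : finType) (hV : (0 < #|V|)%N)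
  (adj : rel V) (adj_sym : symmetric adj) (adj_irr : irreflexive adj)
  (G : dhypergraph V) (hG : is_orientation adj G)
  (e : hyperedge V) (e_all : forall v : V, v \in sour e :|: targ e)
  (e_co : forall u v : V, cooriented e u v) :
  let LG : 'M[C]_#|V| := laplacian C G in
  let LH : 'M[C]_#|V| := laplacian C (hunion G (hsingle e)) in
  perm_eq (spectrum LH)
    (nseq (n_comp adj predT - 1) 0 ++ #|V|%:R :: [seq a <- spectrum LG | a != 0])
  /\
  exists lam_min : C,
    [/\ lowest_eigenvalue LH lam_min,
        lam_min = #|V|%:R <-> complete_graph adj,
        complete_graph adj -> proj_ortho (eigenspace LH lam_min) = 1%:M
      & ~ complete_graph adj ->
        lam_min < #|V|%:R /\ ~ positive_mx (proj_ortho (eigenspace LH lam_min))].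
Proof.
move=> LG LH; pose n := #|V|; pose r : rel 'I_n := relpre (@enum_val V predT) adj.
have sr : symmetric r by move=> i j; apply: adj_sym.
have LGE : LG = rel_laplacian C r by apply: laplacian_graph.
have LHE : LH = rel_laplacian C r + const_mx 1.
  by rewrite /LH laplacian_hunion (laplacian_hsingle _ e_co) -LGE.
split.
  rewrite -(perm_cons 0) LHE; apply: perm_trans (perm_spectrum_add_ones hV _) _.
    exact: rel_laplacian_ones.
  (* It remains to single out the zeros of the spectrum of L, one of which
     cancels against the 0 added in front. *)
  rewrite -/n LGE; set s := spectrum _.
  have c0 : count_mem 0 s = n_comp adj predT.
    rewrite count_zero_spectrum -?mxrank_ker ?rank_ker_rel_laplacian //.
    exact: hermitian_normalmx (rel_laplacian_hermitian _ sr).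
  rewrite -cat1s -[_ :: _ ++ _]/((0 :: nseq _ 0) ++ _).
  rewrite -[0 :: nseq _ _]/(nseq _.+1 0) subn1 prednK ?n_comp_gt0 // -c0.
  rewrite -[n%:R :: filter _ _]cat1s perm_sym perm_catCA perm_cat2l perm_sym.
  exact: perm_nseq_filter.
pose K := rel_laplacian C (fun i j => ~~ r i j).
have sK : symmetric (fun i j => ~~ r i j) by move=> i j; rewrite sr.
have KE : K = n%:R%:M - LH by rewrite LHE; apply: rel_laplacian_compl.
have LHK : LH = n%:R%:M - K by rewrite KE opprB addrC subrK.
have le_n a : eigenvalue LH a -> a <= n%:R.
  move=> /(eigenvalue_scalar_sub n%:R); rewrite -KE -subr_ge0.
  exact: rel_laplacian_eigenvalue_ge0.
(* The spectrum is real, which the order of C requires for a minimum. *)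
have [||m ms mle] := @real_seq_min C (spectrum LH).
- by rewrite -size_eq0 size_spectrum -lt0n.
- by move=> a; rewrite mem_spectrum => /le_n /ler_real; rewrite realn.
have mLH : eigenvalue LH m by rewrite -mem_spectrum.
have low : lowest_eigenvalue LH m.
  by split=> // b; rewrite -mem_spectrum => /mle.
have complete_LH : complete_graph adj -> LH = n%:R%:M.
  move=> cG; rewrite LHK; suff -> : K = 0 by rewrite subr0.
  apply/rel_laplacian_eq0P => i j ij.
  by rewrite negbK; apply: cG; rewrite (inj_eq enum_val_inj).
have mE : m = n%:R <-> complete_graph adj.
  split=> [mn | /complete_LH LHn].
    have /rel_laplacian_eq0P K0 : K = 0.
      apply: rel_laplacian_spectrum0 => // a /(eigenvalue_scalar_sub n%:R).
      (* If n is the lowest eigenvalue of L + J, it is also the highest one. *)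
      rewrite -LHK => aE; suff /eqP : n%:R - a = n%:R.
        by rewrite subr_eq addrC -subr_eq subrr => /eqP.
      by apply/le_anti; rewrite le_n //= -[X in X <= _]mn mle ?mem_spectrum.
    move=> x y xy; have := K0 (enum_rank x) (enum_rank y).
    by rewrite (inj_eq enum_rank_inj) /r /= !enum_rankK negbK; apply.
  move: mLH; rewrite LHn => /eigenvalueP[v].
  rewrite mul_mx_scalar => /eqP; rewrite -subr_eq0 -scalerBl scaler_eq0 subr_eq0.
  by case/orP=> [/eqP-> // | ->].
exists m; split=> //.
  move=> cG; have mn := mE.2 cG; rewrite (complete_LH cG) mn.
  have full : (1%:M <= eigenspace (n%:R%:M : 'M[C]_n) n%:R)%MS.
    by apply/eigenspaceP; rewrite mul1mx scalemx1.
  by rewrite -[LHS]mul1mx proj_ortho_id.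
move=> ncG; have mn : m != n%:R by apply/eqP => /mE.
split; first by rewrite lt_neqAle mn le_n.
apply: proj_ortho_not_positive => //.
have /eigenspaceP EL := submx_refl (eigenspace LH m).
have LH1 : LH *m const_mx 1 = n%:R *: (const_mx 1 : 'cV_n).
  rewrite LHK mulmxBl rel_laplacian_ones subr0 mul_scalar_mx //.
apply/eqP; have := congr1 (mulmx^~ (const_mx 1 : 'cV_n)) EL.
rewrite -mulmxA LH1 -scalemxAr -scalemxAl => /eqP.
by rewrite -subr_eq0 -scalerBl scaler_eq0 subr_eq0 eq_sym (negbTE mn).
Qed.
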